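(* Let $(X,T)$ be a dynamical system. Let $\{\mu_p\}_{p=1}^{\infty}\subset\mathcal{M}_T^e(X)$ and $\{x_p\}_{p=1}^{\infty}\subset X$ be such that $x_p$ is a generic point for $\mu_p$ for every $p\in\mathbb{N}$. If $x\in X$ is such that $D_B(x_p,x)\to 0$ as $p\to\infty$, then $x$ is generic for some $\mu\in\mathcal{M}_T^e(X)$.
   Context: A dynamical system $(X,T)$ is a compact metric space $X$ (metric $\rho$, diameter $1$ without loss of generality) with a continuous map $T\colon X\to X$. $\mathcal{M}_T^e(X)$ is the set of ergodic $T$-invariant Borel probability measures on $X$. The Besicovitch pseudometric on $X$ is $D_B(x,y)=\limsup_{N\to\infty}\frac1N\sum_{n=0}^{N-1}\rho(T^n(x),T^n(y))$. A point $x\in X$ is generic for a Borel probability measure $\mu$ if $\frac1n\sum_{j=0}^{n-1}\hat\delta(T^j(x))\to\mu$ in the weak$^*$ topology, where $\hat\delta(y)$ is the Dirac measure at $y$; equivalently $\lim_{n\to\infty}\frac1n\sum_{j=0}^{n-1}f(T^j(x))=\int_X f\,d\mu$ for every continuous $f\colon X\to\mathbb{R}$. *)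

(* Defs.v *)
From HB Require Import structures.
From mathcomp Require Import all_boot all_order all_algebra.
From mathcomp Require Import all_classical all_reals all_analysis.

Set Implicit Arguments.
Unset Strict Implicit.
Unset Printing Implicit Defensive.

Import Order.TTheory GRing.Theory Num.Theory.
Import numFieldNormedType.Exports.

Local Open Scope classical_set_scope.
Local Open Scope ring_scope.

(* The base point is only there because measurable types are pointed in the
   library: it amounts to nonemptiness and is not used otherwise. *)
#[short(type="pointedMetricType")]
HB.structure Definition PointedMetric (R : numDomainType) :=
  {X of Pointed X & Metric R X}.

Definition borel (R : realType) (X : pointedMetricType R) :=
  g_sigma_algebraType (@open X).

Section dynamical_system.
Context {R : realType} {X : pointedMetricType R}.
Implicit Types (T : X -> X) (x y : X).

Definition invariant_measure T (mu : probability (borel X) R) : Prop :=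
  forall A : set (borel X), measurable A -> mu (T @^-1` A) = mu A.

Definition ergodic_measures T : set (probability (borel X) R) :=
  [set mu | invariant_measure T mu /\
    forall A : set (borel X), measurable A -> T @^-1` A = A ->
      mu A = 0%E \/ mu A = 1%E].

(* For N = 0 the sum is empty and the term is 0. The real-valued limn_sup is
   the limit superior of bounded sequences only; when X is compact, mdist is
   bounded and so are these averages. *)
Definition besicovitch T x y : R :=
  limn_sup (fun N : nat =>
    N%:R^-1 * \sum_(0 <= n < N) mdist (iter n T x) (iter n T y)).

(* The zero measure for n = 0, a probability measure for n > 0. *)
Definition empirical_measure T x (n : nat) :
    {measure set (borel X) -> \bar R} :=
  mscale (n%:R^-1)%:nng
    (msum (fun j : nat => @dirac _ (borel X) (iter j T x) R) n).

Definition weak_star_cvg (nu : nat -> {measure set (borel X) -> \bar R})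
    (mu : {measure set (borel X) -> \bar R}) : Prop :=
  forall f : X -> R, continuous f ->
    (\int[nu n]_z f z) @[n --> \oo] --> \int[mu]_z f z.

Definition generic_point T x (mu : probability (borel X) R) : Prop :=
  weak_star_cvg (empirical_measure T x) mu.

End dynamical_system.

(* Main.v *)
(* Fix a continuous f and put A_n f = (1/n) sum_(i < n) f o T^i. Uniform
   continuity gives |f y - f z| <= e + K rho(y, z), so A_m f is asymptotically
   within e + K D_B(x_p, x) on the orbits of x and x_p. Hence L f = lim A_m f(x)
   exists, and it is a positive normalized functional, represented by a
   probability measure mu for which x is generic.

   The same estimate holds for |A_n f - c| with the same e and K, whatever n and
   c. Therefore the mean ergodic theorem for one mu_p with p large (obtained from
   Garsia's maximal inequality) makes the L^1(mu) distance from A_n f to the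
   constant L f small for some n. Since continuous functions approximate the
   indicator of a T-invariant set B, this forces mu(B) <= mu(B)^2. *)

From HB Require Import structures.
Require Import Defs.
From mathcomp Require Import all_boot all_order all_algebra.
From mathcomp Require Import all_classical all_reals all_analysis.
From mathcomp Require Import measurable_realfun lra ring.

Set Implicit Arguments.
Unset Strict Implicit.
Unset Printing Implicit Defensive.
Import Order.TTheory GRing.Theory Num.Theory.
Import numFieldNormedType.Exports.
Local Open Scope classical_set_scope.
Local Open Scope ring_scope.

(** * Continuous functions and bounded measurable functions *)

(** The obstacle is the order of choices. The time [n] at which the mean ergodic theorem is accurate
    depends on [mus p], and nothing controls it as [p] grows. So [p] is fixed before [n], from [e]
    and the modulus [K] of [f] alone, and must serve every [n] at once; each accuracy uses a single
    [p]. The orbit of [x] gives information on continuous functions only, while ergodicity concerns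
    Borel sets. The bridge is the formula for [mu] as an infimum over increasing sequences of
    continuous functions: it is carried along as [muE] and directly supplies the functions
    approximating an invariant set from above, together with their values under [L]. *)

Section real_continuous.
Context {R : realType} {X : topologicalType}.
Implicit Types f g : X -> R.

Lemma real_continuous_cst (a : R) : continuous (fun _ : X => a).
Proof. by move=> y; exact: cvg_cst. Qed.

Lemma real_continuousD f g : continuous f -> continuous g ->
  continuous (fun y => f y + g y).
Proof. by move=> cf cg y; apply: cvgD; [exact: cf|exact: cg]. Qed.

Lemma real_continuousM f g : continuous f -> continuous g ->
  continuous (fun y => f y * g y).
Proof. by move=> cf cg y; apply: cvgM; [exact: cf|exact: cg]. Qed.

Lemma real_continuousZ (a : R) f : continuous f -> continuous (fun y => a * f y).
Proof. exact/real_continuousM/real_continuous_cst. Qed.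

Lemma real_continuousB f g : continuous f -> continuous g ->
  continuous (fun y => f y - g y).
Proof. by move=> cf cg y; apply: cvgB; [exact: cf|exact: cg]. Qed.

Lemma real_continuous_norm f : continuous f -> continuous (fun y => `|f y|).
Proof. by move=> cf y; apply: cvg_norm; exact: cf. Qed.

Lemma real_continuous_min f g : continuous f -> continuous g ->
  continuous (fun y => Order.min (f y) (g y)).
Proof. by move=> cf cg y; apply: (continuous_min (cf y) (cg y)). Qed.

Lemma real_continuous_max f g : continuous f -> continuous g ->
  continuous (fun y => Order.max (f y) (g y)).
Proof. by move=> cf cg y; apply: (continuous_max (cf y) (cg y)). Qed.

Lemma real_continuous_sum (f : nat -> X -> R) n : (forall i, continuous (f i)) ->
  continuous (fun y => \sum_(i < n) f i y).
Proof.
move=> cf; elim: n => [|n ih].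
  by under eq_fun do rewrite big_ord0; exact: real_continuous_cst.
by under eq_fun do rewrite big_ord_recr/=; exact: real_continuousD.
Qed.

Lemma real_continuous_comp f (T : X -> X) : continuous f -> continuous T ->
  continuous (fun y => f (T y)).
Proof. by move=> cf cT y; apply: continuous_comp; [exact: cT|exact: cf]. Qed.

Lemma continuous_iter n (T : X -> X) : continuous T -> continuous (iter n T).
Proof.
move=> cT; elim: n => [|n ih] y; first exact: cvg_id.
by apply: continuous_comp; [exact: ih|exact: cT].
Qed.

End real_continuous.

Section continuous_functions.
Context {R : realType} {X : pointedMetricType R}.
Implicit Types (f : X -> R) (y z : X) (U : set X).

Lemma near_mdist y (P : X -> Prop) :
  (\forall z \near y, P z) <-> exists2 d : R, 0 < d & forall z, mdist y z < d -> P z.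
Proof.
split=> [/nbhs_ballP[d d0 dP]|[d d0 dP]].
  by exists d => // z yz; apply: dP; rewrite ballEmdist.
by apply/nbhs_ballP; exists d => // z; rewrite ballEmdist; exact: dP.
Qed.

Lemma continuous_mdistP f : continuous f <->
  forall y (e : R), 0 < e ->
    exists2 d : R, 0 < d & forall z, mdist y z < d -> `|f y - f z| < e.
Proof.
split=> [cf y e e0|H y].
  by apply/near_mdist; move/cvgrPdist_lt: (cf y); apply.
by apply/cvgrPdist_lt => e e0; apply/near_mdist; exact: H.
Qed.

Lemma lipschitz_continuous f (k : R) :
  (forall y z, f y <= f z + k * mdist y z) -> continuous f.
Proof.
move=> fk; apply/continuous_mdistP => y e e0.
have k1 : 0 < `|k| + 1 by rewrite ltr_wpDl.
exists (e / (`|k| + 1)); first by rewrite divr_gt0.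
move=> z; rewrite ltr_pdivlMr// => yz.
have kyz : k * mdist y z < e.
  apply: le_lt_trans yz; rewrite mulrC ler_wpM2l ?mdist_ge0//.
  by rewrite (le_trans (ler_norm k))// lerDl.
have := fk y z; have := fk z y; rewrite (metric_sym z y) => ? ?.
by rewrite ltr_norml; apply/andP; split; lra.
Qed.

Lemma dist_to_set (C : set X) : closed C -> C !=set0 ->
  exists d : X -> R, [/\ continuous d, (forall y, 0 <= d y),
    (forall y, C y -> d y = 0) & forall y, ~ C y -> 0 < d y].
Proof.
move=> cC [c0 Cc0]; pose d y := inf [set mdist y c | c in C].
have hi y : has_inf [set mdist y c | c in C].
  split; first by exists (mdist y c0), c0.
  by exists 0 => _ [c _ <-]; exact: mdist_ge0.
have dle y c : C c -> d y <= mdist y c.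
  by move=> Cc; apply: ge_inf; [exact: (hi y).2|exists c].
have d0 y : 0 <= d y.
  by apply: lb_le_inf; [exact: (hi y).1|move=> _ [c _ <-]; exact: mdist_ge0].
exists d; split => // [|y Cy|y nCy].
- apply: (@lipschitz_continuous _ 1) => y z; rewrite mul1r -lerBlDr.
  apply: lb_le_inf; first exact: (hi z).1.
  move=> _ [c Cc <-]; rewrite lerBlDr (le_trans (dle y c Cc))//.
  by rewrite addrC metric_triangle.
- by apply/eqP; rewrite eq_le d0 andbT -(mdistxx y) dle.
- have /near_mdist[e e0 He] : \forall z \near y, ~ C z.
    by apply: open_nbhs_nbhs; split => //; exact: closed_openC.
  apply: (lt_le_trans e0); apply: lb_le_inf; first exact: (hi y).1.
  move=> _ [c Cc <-]; rewrite leNgt; apply/negP => /He; exact.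
Qed.

(** The functions are [min 1 (k * d)] with [d] the distance to the complement of [U]; the whole
    space is treated apart because that complement is then empty. They reach the value 1 instead of
    merely tending to it, so that multiplying by them preserves [majorants]. *)
Lemma open_exhaustion U : open U -> exists u : nat -> X -> R,
  [/\ (forall k, continuous (u k)), (forall k y, 0 <= u k y <= 1),
      (forall k l y, (k <= l)%N -> u k y <= u l y),
      (forall y, ~ U y -> forall k, u k y = 0) &
      forall y, U y -> exists k, u k y = 1].
Proof.
move=> oU; have [->|/eqP C0] := eqVneq U setT.
  exists (fun=> fun=> 1); split => //.
  - by move=> k y; exact: cvg_cst.
  - by move=> k y; rewrite ler01 lexx.
  - by move=> y /(_ I).
  - by move=> y _; exists 0%N.
have {}C0 : ~` U !=set0.
  by apply/set0P/eqP => /(congr1 setC); rewrite setCK setC0.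
have [d [cd d0 dC dU]] := dist_to_set (open_closedC oU) C0.
exists (fun k y => Order.min 1 (k%:R * d y)); split.
- move=> k; apply: real_continuous_min; first exact: real_continuous_cst.
  exact: real_continuousZ.
- by move=> k y; rewrite le_min ler01 mulr_ge0//= ge_min lexx.
- move=> k l y kl; rewrite le_min ge_min lexx/= ge_min; apply/orP; right.
  by rewrite ler_wpM2r ?ler_nat.
- by move=> y nUy k; rewrite dC// mulr0 min_r.
- move=> y Uy; have dy : 0 < d y by apply: dU => /(_ Uy).
  exists (Num.bound (d y)^-1); rewrite min_l// -ler_pdivrMr// mul1r ltW//.
  by rewrite archi_boundP// invr_ge0.
Qed.

Hypothesis compactX : compact [set: X].

Lemma continuous_bounded f : continuous f -> exists M : R, forall y, `|f y| <= M.
Proof.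
move=> cf; have : compact (f @` [set: X]).
  by apply: continuous_compact => //; exact: continuous_subspaceT.
move=> /compact_bounded[M [_ HM]]; exists (M + 1) => y.
by apply: (HM (M + 1)); [rewrite ltrDl|exists y].
Qed.

(** Uniform continuity in affine form: unlike a condition on small distances, this bound can be
    averaged along two orbits. *)
Lemma continuous_modulus f (e : R) : continuous f -> 0 < e ->
  exists2 K : R, 0 <= K & forall y z, `|f y - f z| <= e + K * mdist y z.
Proof.
move=> cf e0; have [M HM] := continuous_bounded cf.
have M0 : 0 <= M := le_trans (normr_ge0 _) (HM point).
have /compact_near_coveringP/(_ _ \oo (fun n y => forall z,
    mdist y z < n.+1%:R^-1 -> `|f y - f z| < e)) := compactX.
case=> [y _|n _ Hn].
  have /continuous_mdistP/(_ y (e / 2))[|d d0 Hd] := cf; first exact: divr_gt0.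
  have d20 : 0 < d / 2 by exact: divr_gt0.
  exists ([set y' | mdist y y' < d / 2], [set n | (n.+1%:R^-1 < d / 2)]).
    split; first by apply/near_mdist; exists (d / 2).
    exact: (near_infty_natSinv_lt (PosNum d20)).
  move=> [y' n] /= [yy' nd] z yz.
  have h1 : `|f y - f y'| < e / 2 by apply: Hd; lra.
  have h2 : `|f y - f z| < e / 2.
    apply: Hd; have := metric_triangle y y' z; have := lt_trans yz nd.
    move: (mdist y y') (mdist y' z) (mdist y z) yy' => a b c; lra.
  rewrite -(subrK (f y) (f y')) -addrA; apply: (le_lt_trans (ler_normD _ _)).
  by rewrite distrC; lra.
(* At distance at least 1/(n+1) the linear term alone exceeds [2 * M], the largest possible
   oscillation of [f]. *)
exists (2 * M * n.+1%:R); first by rewrite !mulr_ge0.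
move=> y z; have [yz|yz] := ltP (mdist y z) n.+1%:R^-1.
  rewrite (le_trans (ltW (Hn n (leqnn n) y I z yz)))// lerDl.
  by rewrite !mulr_ge0 ?mdist_ge0.
apply: (@le_trans _ _ (2 * M * (n.+1%:R * mdist y z))).
  apply: (@le_trans _ _ (2 * M)).
    by rewrite (le_trans (ler_normB _ _))//; have := HM y; have := HM z; lra.
  by rewrite ler_peMr ?mulr_ge0// mulrC -ler_pdivrMr// mul1r.
by rewrite mulrA lerDr ltW.
Qed.

(** The one-sided half of Dini's theorem: an index good at a point stays good nearby by continuity,
    at the price of [e], and later by monotonicity, so compactness gives a common index. *)
Lemma dini_lower (h : nat -> X -> R) (a e : R) : (forall k, continuous (h k)) ->
  (forall k l y, (k <= l)%N -> h k y <= h l y) ->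
  (forall y, exists k, a <= h k y) -> 0 < e ->
  exists k, forall y, a - e < h k y.
Proof.
move=> ch hmon ha e0.
have /compact_near_coveringP/(_ _ \oo (fun n y => a - e < h n y)) := compactX.
case=> [y _|n _ Hn].
  have [k hk] := ha y.
  exists ([set y' | a - e < h k y'], [set n | (k <= n)%N]); last first.
    by move=> [y' n] /= [h1 h2]; exact: lt_le_trans h1 (hmon _ _ _ h2).
  split; last by exists k.
  apply: (cvgr_gt _ (ch k y)); lra.
by exists n => y; exact: (Hn n (leqnn n)).
Qed.

End continuous_functions.

Section bounded_measurable.
Context {d : measure_display} {T : measurableType d} {R : realType}.
Implicit Types f g : T -> R.

(** A class containing continuous functions on a compact space and indicators of Borel sets, closed
    under sums and products, and integrable for every probability measure. *)
Definition bounded_measurable f :=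
  measurable_fun setT f /\ exists M : R, forall y, `|f y| <= M.

Lemma bounded_measurable_cst (a : R) : bounded_measurable (fun=> a).
Proof. by split; [exact: measurable_cst|exists `|a|]. Qed.

Lemma bounded_measurableD f g : bounded_measurable f -> bounded_measurable g ->
  bounded_measurable (fun y => f y + g y).
Proof.
move=> [mf [M HM]] [mg [N HN]]; split; first exact: measurable_funD.
by exists (M + N) => y; rewrite (le_trans (ler_normD _ _))// lerD.
Qed.

Lemma bounded_measurableM f g : bounded_measurable f -> bounded_measurable g ->
  bounded_measurable (fun y => f y * g y).
Proof.
move=> [mf [M HM]] [mg [N HN]]; split; first exact: measurable_funM.
by exists (M * N) => y; rewrite normrM ler_pM.
Qed.

Lemma bounded_measurable_indic (A : set T) : measurable A ->
  bounded_measurable (\1_A : T -> R).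
Proof.
move=> mA; split; first exact: measurable_indic.
by exists 1 => y; rewrite indicE ger0_norm ?ler0n// lern1 leq_b1.
Qed.

Lemma bounded_measurable_sum (f : nat -> T -> R) n :
  (forall i, bounded_measurable (f i)) ->
  bounded_measurable (fun y => \sum_(i < n) f i y).
Proof.
move=> bf; elim: n => [|n ih].
  by under eq_fun do rewrite big_ord0; exact: bounded_measurable_cst.
by under eq_fun do rewrite big_ord_recr/=; exact: bounded_measurableD.
Qed.

Variable mu : probability T R.

Lemma bounded_measurable_integrable f : bounded_measurable f ->
  mu.-integrable setT (EFin \o f).
Proof.
move=> [mf [M HM]]; apply: measurable_bounded_integrable => //.
  by rewrite [ltLHS]probability_setT ltry.
exists M; split => [|x Mx y _]; first exact: num_real.
exact: le_trans (HM y) (ltW Mx).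
Qed.

Local Notation I f := (Rintegral mu setT f).

Lemma Rintegral_bmD f g : bounded_measurable f -> bounded_measurable g ->
  I (fun y => f y + g y) = I f + I g.
Proof.
by move=> bf bg; rewrite RintegralD//; exact: bounded_measurable_integrable.
Qed.

Lemma Rintegral_bmZ (a : R) f : bounded_measurable f ->
  I (fun y => a * f y) = a * I f.
Proof. by move=> bf; rewrite RintegralZl//; exact: bounded_measurable_integrable. Qed.

Lemma Rintegral_prob_cst (a : R) : I (fun=> a) = a.
Proof. by rewrite Rintegral_cst// [X in fine X]probability_setT mulr1. Qed.

Lemma Rintegral_prob_indic (A : set T) : measurable A -> I \1_A = fine (mu A).
Proof. by move=> mA; rewrite /Rintegral integral_indic// setIT. Qed.

Lemma le_Rintegral_bm f g : bounded_measurable f -> bounded_measurable g ->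
  (forall y, f y <= g y) -> I f <= I g.
Proof.
by move=> bf bg fg; apply: le_Rintegral => //; exact: bounded_measurable_integrable.
Qed.

Lemma Rintegral_bm_sum (f : nat -> T -> R) n :
  (forall i, bounded_measurable (f i)) ->
  I (fun y => \sum_(i < n) f i y) = \sum_(i < n) I (f i).
Proof.
move=> bf; elim: n => [|n ih].
  by under eq_fun do rewrite big_ord0; rewrite big_ord0 Rintegral_prob_cst.
under eq_fun do rewrite big_ord_recr/=.
by rewrite Rintegral_bmD ?ih ?big_ord_recr//; exact: bounded_measurable_sum.
Qed.

End bounded_measurable.

Lemma bounded_measurable_comp (d d' : measure_display) (S : measurableType d)
    (T : measurableType d') (R : realType) (phi : S -> T) (f : T -> R) :
  measurable_fun setT phi -> bounded_measurable f -> bounded_measurable (f \o phi).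
Proof.
move=> mphi [mf [M HM]]; split; first exact: measurableT_comp.
by exists M => y; exact: HM.
Qed.

Section continuous_borel.
Context {R : realType} {X : pointedMetricType R}.

Lemma borel_open (U : set X) : open U -> measurable (U : set (borel X)).
Proof. by move=> oU; exact: sub_sigma_algebra. Qed.

Lemma continuous_borel_real (f : X -> R) : continuous f ->
  measurable_fun setT (f : borel X -> R).
Proof.
move=> /continuousP cf; apply: (measurability _ (RGenOpens.measurableE R)).
move=> _ [_ [a [b -> <-]]]; rewrite setTI; apply: borel_open; apply: cf.
exact: interval_open.
Qed.

Lemma continuous_borel (T : X -> X) : continuous T ->
  measurable_fun setT (T : borel X -> borel X).
Proof.
move=> /continuousP cT.
have := @measurability _ _ (borel X) (borel X) setT T (@open X).
apply => //.
by move=> _ [B oB <-]; rewrite setTI; apply: borel_open; exact: cT.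
Qed.

Lemma continuous_bounded_measurable (f : X -> R) : compact [set: X] ->
  continuous f -> bounded_measurable (f : borel X -> R).
Proof.
move=> cX cf; split; first exact: continuous_borel_real.
exact: continuous_bounded.
Qed.

End continuous_borel.

(** * The Riesz representation theorem on a compact metric space *)

Section riesz.
Context {R : realType} {X : pointedMetricType R}.
Implicit Types (A B : set X) (f g : X -> R).

(** [L] is a total function, but is constrained on continuous functions only: it will be a limit of
    averages, which may fail to exist for other functions. *)
Definition positive_functional (L : (X -> R) -> R) : Prop :=
  [/\ (forall f g, continuous f -> continuous g ->
         L (fun y => f y + g y) = L f + L g),
      (forall a f, continuous f -> L (fun y => a * f y) = a * L f),
      (forall f g, continuous f -> continuous g ->
         (forall y, f y <= g y) -> L f <= L g) &
      L (fun=> 1) = 1].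

(* Increasing sequences, rather than series, of continuous functions: the
   Caratheodory criterion for open sets then needs no double sums. *)
Definition majorants A (h : nat -> X -> R) : Prop :=
  [/\ (forall k, continuous (h k)), (forall k y, 0 <= h k y),
      (forall k l y, (k <= l)%N -> h k y <= h l y) &
      forall y, A y -> exists k, 1 <= h k y].

(** Using upper bounds [r] makes the infimum equal to inf over [h] of sup over [k] of [L (h k)],
    without forming the supremum of a possibly unbounded sequence. *)
Definition majorant_values (L : (X -> R) -> R) A : set R :=
  [set r | exists2 h, majorants A h & forall k, L (h k) <= r].

Definition riesz_outer (L : (X -> R) -> R) A : \bar R :=
  (inf (majorant_values L A))%:E.

Lemma majorants_cst A f : continuous f -> (forall y, 0 <= f y) ->
  (forall y, A y -> 1 <= f y) -> majorants A (fun=> f).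
Proof. by move=> cf f0 f1; split => // y /f1; exists 0%N. Qed.

(** A diagonal choice: stage [k] adds the first [k] sequences, each taken at its own stage [k], so
    that every stage is a finite sum. *)
Lemma majorants_bigcup (F : nat -> set X) (h : nat -> nat -> X -> R) :
  (forall n, majorants (F n) (h n)) ->
  majorants (\bigcup_n F n) (fun k y => \sum_(n < k) h n k y).
Proof.
move=> Fh; split=> [k|k y|k l y kl|y [n _ Fny]].
- by apply: (@real_continuous_sum _ _ (h ^~ k)) => n; case: (Fh n).
- by apply: sumr_ge0 => n _; case: (Fh n).
- apply: (@le_trans _ _ (\sum_(n < k) h n l y)).
    by apply: ler_sum => n _; case: (Fh n) => _ _ + _; exact.
  rewrite -!(big_mkord xpredT (fun n => h n l y)) (big_cat_nat (leq0n k) kl)//= lerDl.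
  by apply: sumr_ge0 => n _; case: (Fh n).
- have [_ h0 hmon /(_ y Fny)[k hk]] := Fh n.
  exists (maxn n.+1 k); have nk : (n < maxn n.+1 k)%N by rewrite leq_maxl.
  rewrite (bigD1 (Ordinal nk))//=.
  rewrite (le_trans hk)// (le_trans (hmon k _ y (leq_maxr n.+1 k)))// lerDl.
  by apply: sumr_ge0 => m _; case: (Fh m).
Qed.

Variable L : (X -> R) -> R.
Hypothesis posL : positive_functional L.

Lemma positive_functional0 : L (fun=> 0) = 0.
Proof.
case: posL => _ LZ _ L1.
by have := LZ 0 _ (@real_continuous_cst _ X 1); rewrite !mul0r.
Qed.

Lemma positive_functional_cst (a : R) : L (fun=> a) = a.
Proof.
case: posL => _ LZ _ L1.
by have := LZ a _ (@real_continuous_cst _ X 1); rewrite L1 mulr1.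
Qed.

Lemma positive_functional_ge0 f : continuous f -> (forall y, 0 <= f y) -> 0 <= L f.
Proof.
move=> cf f0; rewrite -positive_functional0; case: posL => _ _ + _; apply => //.
exact: real_continuous_cst.
Qed.

Lemma positive_functionalB f g : continuous f -> continuous g ->
  L (fun y => f y - g y) = L f - L g.
Proof.
move=> cf cg; case: posL => LD LZ _ _.
have := LD _ _ cf (real_continuousZ (a := -1) cg); rewrite LZ// mulN1r => <-.
by congr L; apply/funext => y; rewrite mulN1r.
Qed.

Lemma positive_functional_sum (f : nat -> X -> R) n : (forall i, continuous (f i)) ->
  L (fun y => \sum_(i < n) f i y) = \sum_(i < n) L (f i).
Proof.
move=> cf; case: posL => LD _ _ _; elim: n => [|n ih].
  by under eq_fun do rewrite big_ord0; rewrite big_ord0 positive_functional0.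
under eq_fun do rewrite big_ord_recr/=; rewrite big_ord_recr/=.
by rewrite LD ?ih//; exact: real_continuous_sum.
Qed.

Lemma majorant_values_lb A r : majorant_values L A r -> 0 <= r.
Proof.
move=> [h [ch h0 _ _] hr].
exact: le_trans (positive_functional_ge0 (ch 0%N) (h0 0%N)) (hr 0%N).
Qed.

Lemma majorant_values_has_inf A : has_inf (majorant_values L A).
Proof.
split; last by exists 0 => r; exact: majorant_values_lb.
exists 1, (fun=> fun=> 1); last by move=> k; rewrite positive_functional_cst.
by apply: majorants_cst => //; exact: real_continuous_cst.
Qed.

Lemma riesz_outer_le A r : majorant_values L A r -> fine (riesz_outer L A) <= r.
Proof. by move=> Ar; apply: ge_inf => //; exact: (majorant_values_has_inf A).2. Qed.

Lemma riesz_outer_adherent A (e : R) : 0 < e ->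
  majorant_values L A (fine (riesz_outer L A) + e).
Proof.
move=> e0; have [r [h Ah hr] re] := inf_adherent e0 (majorant_values_has_inf A).
by exists h => // k; rewrite (le_trans (hr k))// ltW.
Qed.

Lemma riesz_outer_ge0 A : (0 <= riesz_outer L A)%E.
Proof.
rewrite lee_fin; apply: lb_le_inf; first exact: (majorant_values_has_inf A).1.
by move=> r; exact: majorant_values_lb.
Qed.

Lemma le_riesz_outer : {homo riesz_outer L : A B / A `<=` B >-> (A <= B)%E}.
Proof.
move=> A B AB; rewrite lee_fin; apply: lb_le_inf.
  exact: (majorant_values_has_inf B).1.
move=> r [h [ch h0 hm hB] hr]; apply: riesz_outer_le.
by exists h => //; split => // y /AB/hB.
Qed.

Lemma riesz_outer0 : riesz_outer L set0 = 0%E.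
Proof.
apply/eqP; rewrite eq_le riesz_outer_ge0 andbT lee_fin; apply: riesz_outer_le.
exists (fun=> fun=> 0); last by move=> k; rewrite positive_functional0.
by apply: majorants_cst => //; exact: real_continuous_cst.
Qed.

Lemma sum_half_pow (e : R) n : \sum_(i < n) e / 2 ^+ i.+1 = e - e / 2 ^+ n.
Proof.
elim: n => [|n ih]; first by rewrite big_ord0 expr0 divr1 subrr.
rewrite big_ord_recr/= ih exprS invfM.
by move: (2 ^- n) => a; field.
Qed.

Lemma riesz_outer_sigma_subadditive : sigma_subadditive (riesz_outer L).
Proof.
move=> F; have S0 k : (0 <= riesz_outer L (F k))%E by exact: riesz_outer_ge0.
have [Soo|Sfin] := eqVneq (\sum_(i <oo) riesz_outer L (F i))%E +oo%E.
  by rewrite Soo leey.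
have Sge0 : (0 <= \sum_(i <oo) riesz_outer L (F i))%E by exact: nneseries_ge0.
have /fineK SE : (\sum_(i <oo) riesz_outer L (F i))%E \is a fin_num.
  by rewrite ge0_fin_numE// ltey.
apply/lee_addgt0Pr => e e0; rewrite -SE -EFinD lee_fin.
have /choice[h Hh] : forall n, exists h, majorants (F n) h /\
    forall k, L (h k) <= fine (riesz_outer L (F n)) + e / 2 ^+ n.+1.
  move=> n; have [|h ? ?] := @riesz_outer_adherent (F n) (e / 2 ^+ n.+1).
    by rewrite divr_gt0// exprn_gt0.
  by exists h.
apply: riesz_outer_le; exists (fun k y => \sum_(n < k) h n k y).
  by apply: majorants_bigcup => n; case: (Hh n).
move=> k; rewrite (@positive_functional_sum (h ^~ k)); last first.
  by move=> n; case: (Hh n) => -[].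
apply: (@le_trans _ _
    (\sum_(n < k) (fine (riesz_outer L (F n)) + e / 2 ^+ n.+1))).
  by apply: ler_sum => n _; exact: (Hh n).2.
rewrite big_split/= sum_half_pow lerD//; last first.
  by rewrite gerBl divr_ge0 ?exprn_ge0// ltW.
rewrite -lee_fin SE -sumEFin.
rewrite -(big_mkord xpredT (fun n => (fine (riesz_outer L (F n)))%:E)).
by apply: nneseries_lim_ge => n _ _; exact: S0.
Qed.

(** A nearly optimal sequence [h] for [A] is split by the exhaustion [u] of [U]. The products
    [h k * u k] majorize the part inside [U]; with one [u N] frozen, [h * (1 - u N)] majorizes the
    part outside, where [u N] vanishes. *)
Lemma riesz_outer_open U A : open U ->
  (riesz_outer L (A `&` U) + riesz_outer L (A `&` ~` U) <= riesz_outer L A)%E.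
Proof.
move=> oU.
suff: fine (riesz_outer L (A `&` U)) + fine (riesz_outer L (A `&` ~` U)) <=
    fine (riesz_outer L A) by rewrite -lee_fin EFinD.
apply/ler_addgt0Pr => e e0.
have e20 : 0 < e / 2 by exact: divr_gt0.
have [h [ch h0 hm hA] hr] := riesz_outer_adherent A e20.
set r := fine (riesz_outer L A) in hr *.
have [u [cu u01 um uC uU]] := open_exhaustion oU.
have u0 k y : 0 <= u k y by have /andP[] := u01 k y.
have u1 k y : u k y <= 1 by have /andP[] := u01 k y.
pose hu k y := h k y * u k y.
have chu k : continuous (hu k) by exact: real_continuousM.
have LE := posL; case: LE => _ _ Lle _.
have hum k l y : (k <= l)%N -> hu k y <= hu l y.
  by move=> kl; rewrite /hu ler_pM ?hm ?um.
have hir : has_sup (range (fun k => L (hu k))).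
  split; first by exists (L (hu 0%N)), 0%N.
  exists (r + e / 2) => _ [k _ <-]; rewrite (le_trans _ (hr k))//.
  by apply: Lle => // y; rewrite /hu ler_piMr.
pose b := sup (range (fun k => L (hu k))).
have Lhub k : L (hu k) <= b by apply: ub_le_sup; [exact: hir.2|exists k].
have h1 : fine (riesz_outer L (A `&` U)) <= b.
  apply: riesz_outer_le; exists hu => //; split => //.
    by move=> k y; rewrite mulr_ge0.
  move=> y [Ay Uy]; have [k hk] := hA y Ay; have [l ul] := uU y Uy.
  exists (maxn k l); have := le_trans hk (hm _ _ y (leq_maxl k l)).
  move=> /le_trans; apply; rewrite /hu ler_peMr//.
  by rewrite -ul um// leq_maxr.
have [_ [N _ <-] bN] := sup_adherent e20 hir; rewrite -/b in bN.
(* Starting [h] at index [N] keeps [h (N + k) * u N] above [hu N], whose [L]-value exceeds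
   [b - e / 2]; this much is subtracted from the bound [r + e / 2]. *)
have h2 : fine (riesz_outer L (A `&` ~` U)) <= r + e / 2 - (b - e / 2).
  have c1u : continuous (fun y => 1 - u N y).
    by apply: real_continuousB => //; exact: real_continuous_cst.
  have gE k : (fun y => h (N + k)%N y * (1 - u N y)) =
      (fun y => h (N + k)%N y - h (N + k)%N y * u N y).
    by apply/funext => y; rewrite mulrBr mulr1.
  apply: riesz_outer_le; exists (fun k y => h (N + k)%N y * (1 - u N y)).
    split.
    - by move=> k; exact: real_continuousM.
    - by move=> k y; rewrite mulr_ge0// subr_ge0.
    - by move=> k l y kl; rewrite ler_wpM2r ?subr_ge0// hm// leq_add2l.
    - move=> y [Ay nUy]; have [k hk] := hA y Ay; exists k.
      by rewrite uC// subr0 mulr1 (le_trans hk)// hm// leq_addl.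
  move=> k; rewrite gE positive_functionalB//; last exact: real_continuousM.
  rewrite lerB// (le_trans (ltW bN))//.
  apply: Lle => //; first exact: real_continuousM.
  by move=> y; rewrite /hu ler_wpM2r// hm// leq_addr.
by move: h1 h2; rewrite /r; lra.
Qed.

Hypothesis compactX : compact [set: X].

Lemma riesz_outer_setT : riesz_outer L setT = 1%E.
Proof.
case: (posL) => _ _ Lle _.
apply/eqP; rewrite eq_le !lee_fin; apply/andP; split.
  apply: riesz_outer_le; exists (fun=> fun=> 1).
    by apply: majorants_cst => //; exact: real_continuous_cst.
  by move=> k; rewrite positive_functional_cst.
apply: lb_le_inf; first exact: (majorant_values_has_inf _).1.
move=> r [h [ch h0 hm hX] hr]; apply/ler_addgt0Pr => e e0.
have [|k hk] := dini_lower compactX ch hm (a := 1) _ e0.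
  by move=> y; exact: hX.
rewrite -lerBlDr -[leLHS]positive_functional_cst (le_trans _ (hr k))//.
by apply: Lle => //; [exact: real_continuous_cst|move=> y; exact/ltW].
Qed.

Lemma riesz_probability : exists mu : probability (borel X) R,
  forall A, mu A = riesz_outer L A.
Proof.
pose mo : {outer_measure set X -> \bar R} := HB.pack (riesz_outer L)
  (isOuterMeasure.Build R X (riesz_outer L) riesz_outer0 riesz_outer_ge0
    le_riesz_outer riesz_outer_sigma_subadditive).
have borel_cara : (measurable : set (set (borel X))) `<=` mo.-cara.-measurable.
  apply: smallest_sub => [|U oU].
    split; [exact: measurable0|by move=> A mA; rewrite setTD; exact: measurableC|].
    by move=> F mF; exact: bigcupT_measurable.
  by apply: le_caratheodory_measurable => A; exact: riesz_outer_open.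
have sa : semi_sigma_additive (riesz_outer L : set (borel X) -> \bar R).
  move=> F mF tF mUF; apply: (@caratheodory_measure_sigma_additive _ _ mo) => //.
    by move=> i; exact: borel_cara (mF i).
  exact: borel_cara mUF.
pose mu0 : {measure set (borel X) -> \bar R} :=
  HB.pack (riesz_outer L : set (borel X) -> \bar R)
    (isMeasure.Build _ (borel X) R (riesz_outer L)
      riesz_outer0 riesz_outer_ge0 sa).
pose mu : probability (borel X) R := HB.pack (Measure.sort mu0)
  (Measure_isProbability.Build _ (borel X) R mu0 riesz_outer_setT).
by exists mu.
Qed.

Section integral.
Variable mu : probability (borel X) R.
Hypothesis muE : forall A, mu A = riesz_outer L A.

Local Notation I f := (Rintegral mu setT f).

Let bm f : continuous f -> bounded_measurable (f : borel X -> R).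
Proof. exact: continuous_bounded_measurable. Qed.

(* Slicing [f] into the layers [min f ((i+1)/n) - min f (i/n)], the i-th layer
   is at most 1/n, vanishes off [f >= i/n], and [n] times the (i-1)-th layer
   majorizes the indicator of that set. *)
Lemma riesz_integral_le f : continuous f -> (forall y, 0 <= f y <= 1) -> I f <= L f.
Proof.
move=> cf f01; apply/ler_addgt0Pr => e e0.
pose n := (Num.bound e^-1).+1.
have n0 : 0 < n%:R :> R by rewrite ltr0n.
have ne : n%:R^-1 <= e.
  rewrite -[e]invrK lef_pV2 ?posrE ?invr_gt0// ltW//.
  by rewrite (lt_trans (archi_boundP _)) ?invr_ge0 ?ltr_nat// ltW.
pose m i y := Order.min (f y) (i%:R / n%:R).
have cm i : continuous (m i).
  by apply: real_continuous_min => //; exact: real_continuous_cst.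
have mle i y : m i y <= m i.+1 y.
  rewrite /m le_min ge_min lexx/= ge_min; apply/orP; right.
  by rewrite ler_wpM2r ?invr_ge0 ?ler_nat// ltW.
pose l i y := m i.+1 y - m i y.
have cl i : continuous (l i) by exact: real_continuousB.
have l0 i y : 0 <= l i y by rewrite subr_ge0.
have fE : f = fun y => \sum_(i < n) l i y.
  apply/funext => y; rewrite -(big_mkord xpredT (l ^~ y)) telescope_sumr//.
  have /andP[f0 f1] := f01 y.
  by rewrite /m divff ?gt_eqF// mul0r min_l// min_r// subr0.
have lle i y : l i y <= n%:R^-1 * \1_[set z | i%:R / n%:R <= f z] y.
  rewrite indicE; have [fy|fy] := leP (i%:R / n%:R) (f y).
    rewrite mem_set//= mulr1 /l /m [X in _ - X]min_r// lerBlDr.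
    by rewrite ge_min -natr1 mulrDl mul1r addrC lexx orbT.
  rewrite memNset/=; last by apply/negP; rewrite -ltNge.
  by rewrite mulr0 subr_le0 /m [leRHS]min_l ?ge_min ?lexx// ltW.
have mset i : measurable ([set z | i%:R / n%:R <= f z] : set (borel X)).
  rewrite -[X in measurable X]setTI.
  have -> : [set z | i%:R / n%:R <= f z] = f @^-1` `[i%:R / n%:R, +oo[.
    by apply/seteqP; split=> z /=; rewrite in_itv/= andbT.
  exact: (continuous_borel_real cf).
have Il i : I (l i) <= n%:R^-1 * fine (mu [set z | i%:R / n%:R <= f z]).
  rewrite -Rintegral_prob_indic// -Rintegral_bmZ; last exact: bounded_measurable_indic.
  apply: le_Rintegral_bm => //; first exact: bm.
  apply: bounded_measurableM; first exact: bounded_measurable_cst.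
  exact: bounded_measurable_indic.
have LZ := posL; case: LZ => _ LZ _ _.
have IlS i : I (l i.+1) <= L (l i).
  apply: le_trans (Il i.+1) _.
  rewrite -(ler_pM2l n0) mulrA divff ?gt_eqF// mul1r muE -LZ//.
  apply: riesz_outer_le; exists (fun=> fun y => n%:R * l i y) => //.
  apply: majorants_cst; first exact: real_continuousZ.
    by move=> y; rewrite mulr_ge0.
  move=> y /= fy; rewrite /l /m min_r// min_r; last first.
    by rewrite (le_trans _ fy)// ler_wpM2r ?invr_ge0 ?ler_nat// ltW.
  by rewrite -mulrBl -natr1 addrAC subrr add0r mul1r divff ?gt_eqF.
rewrite {1}fE Rintegral_bm_sum; last by move=> i; exact: bm.
rewrite [in leRHS]fE positive_functional_sum//.
(* Comparing layer [i + 1] under [I] with layer [i] under [L] leaves the bottom layer without a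
   partner; its integral is at most 1/n, which is the only loss. *)
have Il0 : I (l 0%N) <= e.
  apply: (le_trans (Il 0%N)); apply: le_trans ne.
  rewrite -[leRHS]mulr1 ler_wpM2l ?invr_ge0//.
  by rewrite -lee_fin fineK ?fin_num_measure// probability_le1.
have -> : \sum_(i < n) I (l i) = I (l 0%N) + \sum_(i < n.-1) I (l i.+1).
  by rewrite [in LHS]/n big_ord_recl.
have : \sum_(i < n.-1) L (l i) <= \sum_(i < n) L (l i).
  have -> : \sum_(i < n) L (l i) = \sum_(i < n.-1) L (l i) + L (l n.-1).
    by rewrite [in LHS]/n big_ord_recr.
  by rewrite lerDl positive_functional_ge0.
have : \sum_(i < n.-1) I (l i.+1) <= \sum_(i < n.-1) L (l i).
  by apply: ler_sum => i _; exact: IlS.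
by move: Il0; lra.
Qed.

(** The inequality applied to [1 - g] gives the reverse one for [g], as both functionals send 1 to
    1. An affine change of values brings any continuous function into [0, 1]. *)
Lemma riesz_integral f : continuous f -> I f = L f.
Proof.
have E01 g : continuous g -> (forall y, 0 <= g y <= 1) -> I g = L g.
  move=> cg g01; apply/eqP; rewrite eq_le riesz_integral_le//=.
  pose g' y := 1 + -1 * g y.
  have cg' : continuous (fun y => -1 * g y) by exact: real_continuousZ.
  have := @riesz_integral_le g'; rewrite /g' Rintegral_bmD; last 2 first.
  - exact: bounded_measurable_cst.
  - exact: bm.
  case: (posL) => -> // => [LZ _ _|]; last exact: real_continuous_cst.
  rewrite Rintegral_prob_cst positive_functional_cst Rintegral_bmZ ?LZ//; last exact: bm.
  rewrite lerD2l !mulN1r lerN2; apply.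
    by apply: real_continuousD => //; exact: real_continuous_cst.
  by move=> y; have /andP[] := g01 y; rewrite mulN1r; move: (g y) => ? ? ?; lra.
move=> cf; have [M HM] := continuous_bounded compactX cf.
pose N := M + 1; have N0 : 0 < N.
  by rewrite ltr_wpDl// (le_trans _ (HM point)).
pose g y := (2 * N)^-1 * (f y + N).
have cfN : continuous (fun y => f y + N).
  by apply: real_continuousD => //; exact: real_continuous_cst.
have cg : continuous g by exact: real_continuousZ.
have := E01 g cg; rewrite /g Rintegral_bmZ; last exact: bm.
case: (posL) => LD LZ _ _; rewrite LZ// LD//; last exact: real_continuous_cst.
rewrite Rintegral_bmD; [|exact: bm|exact: bounded_measurable_cst].
rewrite Rintegral_prob_cst positive_functional_cst => H.
have N2 : (2 * N)^-1 != 0 by rewrite invr_eq0 mulf_neq0// gt_eqF.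
apply/(addIr N)/(mulfI N2)/H => y.
have := HM y; rewrite ler_norml => /andP[fM Mf].
have NN : 0 < 2 * N by rewrite mulr_gt0.
apply/andP; split; first by rewrite pmulr_rge0 ?invr_gt0// /N; lra.
by rewrite [leLHS]mulrC ler_pdivrMr// mul1r /N; lra.
Qed.

End integral.

End riesz.

(** * Birkhoff averages and the mean ergodic theorem *)

Section decreasing_null.
Context {d : measure_display} {T : measurableType d} {R : realType}.

Lemma decreasing_null (mu : probability T R) (F : nat -> set T) (e : R) :
  (forall n, measurable (F n)) -> (forall n m, (n <= m)%N -> F m `<=` F n) ->
  mu (\bigcap_n F n) = 0%E -> 0 < e -> exists n, fine (mu (F n)) < e.
Proof.
move=> mF dF F0 e0.
have : mu \o F @ \oo --> mu (\bigcap_n F n).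
  apply: nonincreasing_cvg_mu => //.
  - by rewrite (le_lt_trans (probability_le1 mu (mF 0%N))) ?ltry.
  - exact: bigcapT_measurable.
  - by move=> n m nm; apply/subsetPset; exact: dF.
rewrite F0 => /fine_cvgP[_ /cvgrPdist_lt/(_ e e0)][n _ /(_ n (leqnn n))].
rewrite /= sub0r normrN ger0_norm ?fine_ge0//.
by exists n.
Qed.

End decreasing_null.

Section birkhoff_averages.
Context {R : realType} {X : pointedMetricType R}.
Implicit Types (f g : X -> R) (T : X -> X) (y : X).

Definition birkhoff_sum T f (n : nat) y : R := \sum_(i < n) f (iter i T y).

Definition birkhoff_average T f (n : nat) y : R := n%:R^-1 * birkhoff_sum T f n y.

Lemma birkhoff_sumS T f n y :
  birkhoff_sum T f n.+1 y = f y + birkhoff_sum T f n (T y).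
Proof.
rewrite /birkhoff_sum big_ord_recl/=; congr (_ + _).
by apply: eq_bigr => i _; rewrite -iterSr.
Qed.

Lemma birkhoff_sumD T f g n y :
  birkhoff_sum T (fun z => f z + g z) n y = birkhoff_sum T f n y + birkhoff_sum T g n y.
Proof. exact: big_split. Qed.

Lemma birkhoff_sumZ T a f n y :
  birkhoff_sum T (fun z => a * f z) n y = a * birkhoff_sum T f n y.
Proof. by rewrite /birkhoff_sum mulr_sumr. Qed.

Lemma birkhoff_sum_cst T (a : R) n y : birkhoff_sum T (fun=> a) n y = n%:R * a.
Proof. by rewrite /birkhoff_sum sumr_const card_ord mulr_natl. Qed.

Lemma le_birkhoff_sum T f g n y : (forall z, f z <= g z) ->
  birkhoff_sum T f n y <= birkhoff_sum T g n y.
Proof. by move=> fg; apply: ler_sum. Qed.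

Lemma birkhoff_averageD T f g n y :
  birkhoff_average T (fun z => f z + g z) n y =
  birkhoff_average T f n y + birkhoff_average T g n y.
Proof. by rewrite /birkhoff_average birkhoff_sumD mulrDr. Qed.

Lemma birkhoff_averageZ T a f n y :
  birkhoff_average T (fun z => a * f z) n y = a * birkhoff_average T f n y.
Proof. by rewrite /birkhoff_average birkhoff_sumZ mulrCA. Qed.

Lemma birkhoff_average_cst T (a : R) n y : (0 < n)%N ->
  birkhoff_average T (fun=> a) n y = a.
Proof.
by move=> n0; rewrite /birkhoff_average birkhoff_sum_cst mulKf// pnatr_eq0 -lt0n.
Qed.

Lemma le_birkhoff_average T f g n y : (forall z, f z <= g z) ->
  birkhoff_average T f n y <= birkhoff_average T g n y.
Proof. by move=> fg; rewrite ler_wpM2l ?invr_ge0// le_birkhoff_sum. Qed.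

Lemma birkhoff_sum_continuous T f n : continuous T -> continuous f ->
  continuous (birkhoff_sum T f n).
Proof.
move=> cT cf; apply: (@real_continuous_sum _ _ (fun i y => f (iter i T y))) => i.
apply: real_continuous_comp => //; exact: continuous_iter.
Qed.

Lemma birkhoff_average_continuous T f n : continuous T -> continuous f ->
  continuous (birkhoff_average T f n).
Proof. by move=> cT cf; apply/real_continuousZ/birkhoff_sum_continuous. Qed.

End birkhoff_averages.

Section invariant_measures.
Context {R : realType} {X : pointedMetricType R}.
Variables (T : X -> X) (mu : probability (borel X) R).
Hypotheses (cT : continuous T) (invmu : invariant_measure T mu).

Local Notation I f := (Rintegral mu setT f).

Lemma Rintegral_invariant (f : borel X -> R) : bounded_measurable f ->
  I (f \o T) = I f.
Proof.
move=> bf; have mT := continuous_borel cT.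
have mf := bf.1.
rewrite /Rintegral; congr fine.
transitivity (\int[pushforward mu (T : borel X -> borel X)]_z (f z)%:E)%E.
  rewrite integral_pushforward//.
    exact/measurable_EFinP.
  apply: bounded_measurable_integrable.
  exact: (bounded_measurable_comp mT bf).
by apply: eq_measure_integral => A mA _; exact: invmu.
Qed.

Lemma Rintegral_invariant_iter n (f : borel X -> R) : bounded_measurable f ->
  I (f \o iter n T) = I f.
Proof.
move=> bf; elim: n => [|n ih]//.
rewrite -[RHS]ih -[RHS]Rintegral_invariant; last first.
  exact: (bounded_measurable_comp (continuous_borel (continuous_iter cT)) bf).
by congr Rintegral; apply/funext => y /=; rewrite -iterSr.
Qed.

Lemma bounded_measurable_birkhoff_average n (f : borel X -> R) :
  bounded_measurable f -> bounded_measurable (birkhoff_average T f n : borel X -> R).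
Proof.
move=> bf; pose fT i (y : borel X) := f (iter i T y).
have bi i : bounded_measurable (fT i).
  exact: (bounded_measurable_comp (continuous_borel (continuous_iter cT)) bf).
exact: bounded_measurableM (bounded_measurable_cst _) (bounded_measurable_sum n bi).
Qed.

Lemma Rintegral_birkhoff_average n (f : borel X -> R) : (0 < n)%N ->
  bounded_measurable f -> I (birkhoff_average T f n) = I f.
Proof.
move=> n0 bf.
pose fT i (y : borel X) := f (iter i T y).
have bi i : bounded_measurable (fT i).
  exact: (bounded_measurable_comp (continuous_borel (continuous_iter cT)) bf).
rewrite Rintegral_bmZ; last exact: (bounded_measurable_sum n bi).
rewrite (Rintegral_bm_sum mu n bi) (eq_bigr (fun=> I f)); last first.
  by move=> i _; exact: Rintegral_invariant_iter.
by rewrite sumr_const card_ord -[I f *+ n]mulr_natl mulKf// pnatr_eq0 -lt0n.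
Qed.

(** This is the maximum of the Birkhoff sums of [g] at [y] over the times 0 to [N]. The recursive
    form is the relation with [T] on which Garsia's argument rests. *)
Fixpoint maximal_sum (g : X -> R) (N : nat) (y : X) : R :=
  if N is N'.+1 then Order.max 0 (g y + maximal_sum g N' (T y)) else 0.

Lemma maximal_sum_ge0 g N y : 0 <= maximal_sum g N y.
Proof. by case: N => [|N]//=; rewrite le_max lexx. Qed.

Lemma maximal_sum_continuous g N : continuous g -> continuous (maximal_sum g N).
Proof.
move=> cg; elim: N => [|N ih]; first exact: real_continuous_cst.
apply: real_continuous_max; first exact: real_continuous_cst.
by apply: real_continuousD => //; exact: real_continuous_comp.
Qed.

Lemma maximal_sum_mon g N y : maximal_sum g N y <= maximal_sum g N.+1 y.
Proof.
elim: N y => [|N ih] y; first exact: maximal_sum_ge0.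
by rewrite [leLHS]/= [leRHS]/= ge_max !le_max lexx/= lerD2l ih orbT.
Qed.

Lemma birkhoff_sum_le_maximal g N y : birkhoff_sum T g N y <= maximal_sum g N y.
Proof.
elim: N y => [|N ih] y; first by rewrite /birkhoff_sum big_ord0.
by rewrite birkhoff_sumS/= le_max lerD2l ih orbT.
Qed.

Hypothesis compactX : compact [set: X].

Let bm (f : X -> R) : continuous f -> bounded_measurable (f : borel X -> R).
Proof. exact: continuous_bounded_measurable. Qed.

(* Garsia's argument: where the maximal sum [F] is positive, [F - F \o T <= g],
   and [F - F \o T] has integral 0. *)
Lemma garsia_maximal_inequality (g : X -> R) (K : R) N : continuous g ->
  (forall y, `|g y| <= K) ->
  0 <= I g + K * fine (mu [set y | maximal_sum g N y <= 0]).
Proof.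
move=> cg gK; pose F := maximal_sum g N.
have cF : continuous F by exact: maximal_sum_continuous.
have mA : measurable ([set y | F y <= 0] : set (borel X)).
  rewrite -[X in measurable X]setTI.
  have -> : [set y | F y <= 0] = F @^-1` `]-oo, 0].
    by apply/seteqP; split=> z /=; rewrite in_itv.
  exact: (continuous_borel_real cF).
have b1 := @bounded_measurable_indic _ _ R _ mA.
have bK := bounded_measurableM (bounded_measurable_cst K) b1.
rewrite -Rintegral_prob_indic// -Rintegral_bmZ// -Rintegral_bmD//; last exact: bm.
have F0 : I (fun y => F y + -1 * (F \o T) y) = 0.
  have cFT : continuous (F \o T) by exact: real_continuous_comp.
  rewrite Rintegral_bmD; [|exact: bm|exact/bm/real_continuousZ].
  rewrite Rintegral_bmZ; last exact: bm.
  by rewrite Rintegral_invariant; [rewrite mulN1r subrr|exact: bm].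
rewrite -[leLHS]F0; apply: le_Rintegral_bm.
- by apply/bm/real_continuousD => //; exact/real_continuousZ/real_continuous_comp.
- exact: (bounded_measurableD (bm cg) bK).
move=> y; rewrite mulN1r indicE lerBlDr /=.
have [Fy|Fy] := leP (F y) 0.
  rewrite mem_set//= mulr1; have := maximal_sum_ge0 g N (T y).
  have := gK y; rewrite ler_norml => /andP[+ _].
  by move: Fy; rewrite /F; lra.
rewrite memNset/=; last by apply/negP; rewrite -ltNge.
(* A positive value must come from the second argument of the maximum, and passing from [N'] to
   [N'.+1] there only increases it. *)
rewrite mulr0 addr0; move: Fy; rewrite /F; case: (N) => [|N']; first by rewrite ltxx.
rewrite [in X in X -> _]/= lt_max ltxx/= => Fy.
by rewrite [leLHS]/= ge_max (ltW (lt_le_trans Fy _)) lerD2l maximal_sum_mon.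
Qed.

End invariant_measures.

(** * From the maximal inequality to the mean ergodic theorem *)

Section ergodic_measures.
Context {R : realType} {X : pointedMetricType R}.
Variables (T : X -> X) (mu : probability (borel X) R).
Hypotheses (compactX : compact [set: X]) (cT : continuous T)
  (ergmu : ergodic_measures T mu).

Local Notation I f := (Rintegral mu setT f).

Let bm (f : X -> R) : continuous f -> bounded_measurable (f : borel X -> R).
Proof. exact: continuous_bounded_measurable. Qed.

Let superlevel (g : X -> R) (M : nat) : set (borel X) :=
  [set y | exists n, M%:R < birkhoff_sum T g n y].

Let superlevelE g M :
  superlevel g M = \bigcup_n [set y | M%:R < birkhoff_sum T g n y].
Proof. by apply/seteqP; split=> [y [n yn]|y [n _ yn]]; exists n. Qed.

Let measurable_superlevel g M : continuous g -> measurable (superlevel g M).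
Proof.
move=> cg; rewrite superlevelE; apply: bigcupT_measurable => n.
rewrite -[X in measurable X]setTI.
have -> : [set y | M%:R < birkhoff_sum T g n y] =
    birkhoff_sum T g n @^-1` `]M%:R, +oo[.
  by apply/seteqP; split=> z /=; rewrite in_itv/= andbT.
exact: (continuous_borel_real (birkhoff_sum_continuous (n := n) cT cg)).
Qed.

(* The set of points with unbounded Birkhoff sums is invariant, so it is null or
   conull; the maximal inequality rules out the latter. *)
Lemma ergodic_unbounded_sums_null (g : X -> R) : continuous g -> I g < 0 ->
  mu (\bigcap_M superlevel g M) = 0%E.
Proof.
move=> cg Ig; set B := \bigcap_M _.
have [K HK] := continuous_bounded compactX cg.
have mB : measurable B.
  by apply: bigcapT_measurable => M; exact: measurable_superlevel.
(* Moving the starting point by one step changes a Birkhoff sum by one term, at most [K] in absolute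
   value; the level [M + Num.bound K] absorbs it. *)
have inB : T @^-1` B = B.
  apply/seteqP; split=> y.
    move=> By M _; have [n] := By (M + Num.bound K)%N Logic.I.
    rewrite natrD => yn; exists n.+1; rewrite birkhoff_sumS.
    have := HK y; rewrite ler_norml => /andP[+ _].
    have := archi_boundP (le_trans (normr_ge0 _) (HK y)).
    by move: yn; lra.
  move=> By M _; have [n] := By (M + Num.bound K)%N Logic.I.
  have K0 := archi_boundP (le_trans (normr_ge0 _) (HK y)).
  case: n => [|n]; first by rewrite /birkhoff_sum big_ord0 ltrn0.
  rewrite natrD birkhoff_sumS => yn; exists n.
  have := HK y; rewrite ler_norml => /andP[_ +].
  by move: yn; lra.
have [//|B1] := ergmu.2 B mB inB; exfalso.
pose F N : set (borel X) := [set y | maximal_sum T g N y <= 0].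
have mF N : measurable (F N).
  rewrite -[X in measurable X]setTI.
  have -> : F N = maximal_sum T g N @^-1` `]-oo, 0].
    by apply/seteqP; split=> z /=; rewrite in_itv.
  exact: (continuous_borel_real (maximal_sum_continuous (N := N) cT cg)).
have F0 : mu (\bigcap_N F N) = 0%E.
  have mC : measurable (\bigcap_N F N) by exact: bigcapT_measurable.
  apply/eqP; rewrite eq_le measure_ge0 andbT.
  apply: (@le_trans _ _ (mu (~` B))); last first.
    by rewrite probability_setC// B1 subee.
  apply: le_measure; rewrite ?inE//; first exact: measurableC.
  move=> y Fy /(_ 0%N Logic.I)[n]; rewrite ltNge => /negP; apply.
  exact: le_trans (birkhoff_sum_le_maximal _ _ _ _) (Fy n Logic.I).
have K1 : 0 < K + 1 by rewrite ltr_wpDl// (le_trans _ (HK point)).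
(* This bound makes [K] times the measure of [F N] smaller than [- I g], against the maximal
   inequality; [K + 1] avoids dividing by 0. *)
have [||N HN] := decreasing_null (e := - I g / (K + 1)) mF _ F0.
- move=> n m nm y; apply: le_trans.
  elim: m nm => [|m ih]; first by rewrite leqn0 => /eqP ->.
  rewrite leq_eqVlt => /predU1P[->//|nm].
  exact: le_trans (ih nm) (maximal_sum_mon _ _ _ _).
- by rewrite divr_gt0// oppr_gt0.
have gar : 0 <= I g + K * fine (mu (F N)).
  exact: (garsia_maximal_inequality cT ergmu.1 compactX N cg HK).
have a0 : 0 <= fine (mu (F N)) by rewrite fine_ge0.
move: HN; rewrite ltr_pdivlMr// mulrDr mulr1 [_ * K]mulrC.
by move: (fine (mu (F N))) a0 gar => a a0 gar; lra.
Qed.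

(** An upper bound on the averages is enough: since [A - c] has integral 0, its L^1 norm is twice
    the integral of its positive part. The upper bound holds because [f - (c + d)] has negative
    integral, so its Birkhoff sums stay below some [M] off a small set. The total error is [6 * d],
    within [e = 8 * d]. *)
Lemma ergodic_mean (f : X -> R) (e : R) : continuous f -> 0 < e ->
  exists2 n, (0 < n)%N &
    I (fun y => `|birkhoff_average T f n y - I f|) <= e.
Proof.
move=> cf e0; pose c := I f; pose d := e / 8; pose g y := f y - (c + d).
have d0 : 0 < d by rewrite /d; lra.
have cg : continuous g by apply: real_continuousB => //; exact: real_continuous_cst.
have [K HK] := continuous_bounded compactX cg.
have K1 : 0 < K + 1 by rewrite ltr_wpDl// (le_trans _ (HK point)).
have Ig : I g < 0.
  rewrite Rintegral_bmD; [|exact: bm|exact: bounded_measurable_cst].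
  by rewrite Rintegral_prob_cst -/c; lra.
have mE M := measurable_superlevel M cg.
have [||M HM] := decreasing_null (e := d / (K + 1)) mE _
    (ergodic_unbounded_sums_null cg Ig).
- move=> n m nm y [k yk]; exists k; apply: le_lt_trans yk.
  by rewrite ler_nat.
- exact: divr_gt0.
pose n := (Num.bound (M%:R / d)).+1.
have n0 : 0 < n%:R :> R by rewrite ltr0n.
have nM : n%:R^-1 * M%:R <= d.
  rewrite mulrC ler_pdivrMr// mulrC -ler_pdivrMr// ltW//.
  by rewrite (lt_trans (archi_boundP _)) ?ltr_nat// divr_ge0// ltW.
exists n => //; rewrite -/c.
set E := superlevel g M in HM mE.
have b1 := @bounded_measurable_indic _ _ R _ (mE M).
pose A := birkhoff_average T f n.
have cA : continuous A by exact: birkhoff_average_continuous.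
have IA : I A = c by rewrite Rintegral_birkhoff_average//; [exact: ergmu.1|exact: bm].
have gE y : n%:R^-1 * birkhoff_sum T g n y = A y - (c + d).
  rewrite /A /birkhoff_average birkhoff_sumD birkhoff_sum_cst mulrDr mulKf//.
  by rewrite gt_eqF.
have gle y : n%:R^-1 * birkhoff_sum T g n y <= d + (K + 1) * \1_E y.
  rewrite indicE; have [yE|yE] := pselect (E y).
    rewrite mem_set//= mulr1.
    apply: (@le_trans _ _ (K + 1)); last by rewrite lerDr ltW.
    apply: (@le_trans _ _ (n%:R^-1 * (n%:R * (K + 1)))); last first.
      by rewrite mulKf ?gt_eqF.
    rewrite ler_wpM2l ?invr_ge0// -(birkhoff_sum_cst T (K + 1) n y).
    apply: le_birkhoff_sum => z; rewrite (le_trans (ler_norm _))//.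
    by rewrite (le_trans (HK z))// lerDl.
  rewrite memNset//= mulr0 addr0 (le_trans _ nM)// ler_wpM2l ?invr_ge0//.
  by rewrite leNgt; apply/negP => Hy; apply: yE; exists n.
(* The absolute value is twice the positive part minus the function itself, and the positive part is
   at most [2 * d + (K + 1) * \1_E y]. *)
have ple y : `|A y - c| <= (4 * d + c) + (2 * (K + 1) * \1_E y + -1 * A y).
  have := gle y; rewrite gE => H.
  have : 0 <= (K + 1) * \1_E y by rewrite mulr_ge0 ?(ltW K1)// indicE ler0n.
  rewrite -[2 * _ * _]mulrA; move: (_ * \1_E y) H => a H a0.
  by rewrite ler_norml; apply/andP; split; lra.
have bA : bounded_measurable (A : borel X -> R) by exact: bm.
have bNA := bounded_measurableM (bounded_measurable_cst (-1)) bA.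
have bE := bounded_measurableM (bounded_measurable_cst (2 * (K + 1))) b1.
have bS := bounded_measurableD bE bNA.
apply: (@le_trans _ _ (I (fun y => (4 * d + c) + (2 * (K + 1) * \1_E y + -1 * A y)))).
  apply: le_Rintegral_bm => //.
    apply/bm/real_continuous_norm/real_continuousB => //.
    exact: real_continuous_cst.
  exact: bounded_measurableD (bounded_measurable_cst _) bS.
rewrite (Rintegral_bmD mu (bounded_measurable_cst _) bS) (Rintegral_bmD mu bE bNA).
rewrite (Rintegral_bmZ mu _ b1) (Rintegral_bmZ mu _ bA) Rintegral_prob_cst IA.
rewrite Rintegral_prob_indic//.
move: HM; rewrite ltr_pdivlMr// mulrC -mulrA; move: (_ * fine _) => a.
by rewrite /d; lra.
Qed.

End ergodic_measures.

(** * Generic points and the Besicovitch pseudometric *)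

Section empirical_measures.
Context {R : realType} {X : pointedMetricType R}.
Implicit Types (f : X -> R) (T : X -> X) (x : X).

Lemma empirical_integral_ge0 T x n (f : borel X -> R) :
  measurable_fun setT f -> (forall y, 0 <= f y) ->
  (\int[empirical_measure T x n]_z (f z)%:E)%E = (birkhoff_average T f n x)%:E.
Proof.
move=> mf f0; have mEf : measurable_fun setT (EFin \o f) by exact/measurable_EFinP.
rewrite ge0_integral_mscale//; last by move=> z _; rewrite lee_fin.
rewrite ge0_integral_measure_sum//; last by move=> z _; rewrite lee_fin.
rewrite /birkhoff_average EFinM /birkhoff_sum -sumEFin; congr (_ * _)%E.
by apply: eq_bigr => i _; rewrite integral_dirac// diracT mul1e.
Qed.

Lemma empirical_integral T x n (f : borel X -> R) : measurable_fun setT f ->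
  Rintegral (empirical_measure T x n) setT f = birkhoff_average T f n x.
Proof.
move=> mf; rewrite /Rintegral integralE.
have -> : (EFin \o f)^\+%E = EFin \o f^\+%R by rewrite funerpos.
have -> : (EFin \o f)^\-%E = EFin \o f^\-%R by rewrite funerneg.
rewrite !empirical_integral_ge0//; [|exact: measurable_funrneg|exact: measurable_funrpos].
rewrite /= /birkhoff_average -mulrBr; congr (_ * _).
rewrite /birkhoff_sum -sumrB; apply: eq_bigr => i _.
exact: (congr1 (@^~ (iter i T x)) (funrposBneg f)).
Qed.

Lemma generic_pointP T x (mu : probability (borel X) R) :
  generic_point T x mu <-> forall f, continuous f ->
    birkhoff_average T f n x @[n --> \oo] --> Rintegral mu setT f.
Proof.
have E f : continuous f ->
    (fun n => Rintegral (empirical_measure T x n) setT f) =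
    (fun n => birkhoff_average T f n x).
  by move=> cf; apply/funext => n; rewrite empirical_integral//;
  exact: continuous_borel_real.
by split=> H f cf; [rewrite -E//|rewrite E//]; exact: H.
Qed.

End empirical_measures.

Section orbits.
Context {R : realType} {X : pointedMetricType R}.
Hypothesis compactX : compact [set: X].
Implicit Types (f g : X -> R) (T : X -> X) (x y z : X).

Lemma mdist_bounded : exists D : R, forall y z : X, mdist y z <= D.
Proof.
have cd : continuous (fun y : X => mdist point y).
  apply: (@lipschitz_continuous _ _ _ 1) => y z.
  by rewrite mul1r (metric_sym y z) metric_triangle.
have [M HM] := continuous_bounded compactX cd; exists (M + M) => y z.
rewrite (le_trans (metric_triangle y point z))// lerD//.
  by rewrite metric_sym (le_trans (ler_norm _)).
by rewrite (le_trans (ler_norm _)).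
Qed.

Lemma limn_sup_lt (u : nat -> R) (a : R) : bounded_fun u -> limn_sup u < a ->
  \forall n \near \oo, u n < a.
Proof.
move=> bu; rewrite limn_supE// => /inf_lt[|_ [n _ <-] na].
  by exists (sups u 0%N), 0%N.
exists n => // m /= nm; apply: le_lt_trans na.
apply: ub_le_sup; last by exists m.
have [M HM] := bounded_fun_has_ubound bu.
by exists M => _ [k _ <-]; apply: HM; exists k.
Qed.

Lemma besicovitch_lt T x y (a : R) : besicovitch T x y < a ->
  \forall N \near \oo,
    N%:R^-1 * \sum_(n < N) mdist (iter n T x) (iter n T y) < a.
Proof.
have [D HD] := mdist_bounded.
have D0 : 0 <= D := le_trans (mdist_ge0 _ _) (HD point point).
rewrite /besicovitch; under eq_fun do rewrite big_mkord.
move=> /limn_sup_lt; apply; exists D; split=> [|M DM N _]; first exact: num_real.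
have s0 : 0 <= \sum_(n < N) mdist (iter n T x) (iter n T y).
  by apply: sumr_ge0 => n _; exact: mdist_ge0.
rewrite /= ger0_norm ?mulr_ge0 ?invr_ge0//; apply: le_trans (ltW DM).
have [->|N0] := posnP N; first by rewrite invr0 mul0r.
rewrite mulrC ler_pdivrMr ?ltr0n// mulr_natr.
apply: (@le_trans _ _ (\sum_(n < N) D)); first exact: ler_sum.
by rewrite sumr_const card_ord.
Qed.

(* The bound does not depend on [n]: shifting an orbit by [j < n] changes the
   sum of distances by at most [n D], which [m] absorbs. *)
Lemma orbit_close T x z g (n : nat) (e K d : R) : 0 <= K -> 0 < e -> (0 < n)%N ->
  K * d <= e ->
  (\forall m \near \oo,
     m%:R^-1 * \sum_(i < m) mdist (iter i T x) (iter i T z) < d) ->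
  (forall y w, `|g y - g w| <=
     e + K * (n%:R^-1 * \sum_(j < n) mdist (iter j T y) (iter j T w))) ->
  \forall m \near \oo,
    `|birkhoff_average T g m x - birkhoff_average T g m z| <= 3 * e.
Proof.
move=> K0 e0 n0 Kd Hd Hg; have [D HD] := mdist_bounded.
have D0 : 0 <= D := le_trans (mdist_ge0 _ _) (HD point point).
pose r i := mdist (iter i T x) (iter i T z).
have r0 i : 0 <= r i by exact: mdist_ge0.
(* The window from [j] to [m + j] lies in the first [m + j] indices, of which only the last [j] are
   new. *)
have shift m j : (j < n)%N -> \sum_(i < m) r (i + j)%N <= \sum_(i < m) r i + n%:R * D.
  move=> jn; apply: (@le_trans _ _ (\sum_(0 <= i < m + j) r i)).
    rewrite (big_cat_nat (leq0n j) (leq_addl m j))/=.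
    rewrite -[X in _ + \sum_(X <= _ < _) _]add0n big_addn addnK !big_mkord lerDr.
    by apply: sumr_ge0 => i _; exact: r0.
  rewrite (big_cat_nat (leq0n m) (leq_addr j m))/= big_mkord lerD2l.
  rewrite -[X in \sum_(X <= _ < _) _]add0n big_addn addKn big_mkord.
  apply: (@le_trans _ _ (\sum_(i < j) D)); first by apply: ler_sum => i _; exact: HD.
  by rewrite sumr_const card_ord -[leLHS]mulr_natl ler_wpM2r// ler_nat ltnW.
near=> m.
have m0 : (0 < m)%N by near: m; exact: nbhs_infty_gt.
have mR : 0 < m%:R :> R by rewrite ltr0n.
have nR : 0 < n%:R :> R by rewrite ltr0n.
have : m%:R^-1 * \sum_(i < m) r i < d by near: m; exact: Hd.
set a := _ * _ => ad.
have mbig : K * (n%:R * D) / e <= m%:R by near: m; exact: nbhs_infty_ger.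
have bnd j : (j < n)%N -> \sum_(i < m) r (i + j)%N <= m%:R * a + n%:R * D.
  by move=> jn; rewrite /a mulVKf ?gt_eqF// shift.
have -> : birkhoff_average T g m x - birkhoff_average T g m z =
    m%:R^-1 * \sum_(i < m) (g (iter i T x) - g (iter i T z)).
  by rewrite /birkhoff_average -mulrBr /birkhoff_sum -sumrB.
rewrite normrM ger0_norm ?invr_ge0// mulrC ler_pdivrMr//.
apply: (le_trans (ler_norm_sum _ _ _)).
apply: (@le_trans _ _
    (\sum_(i < m) (e + K * (n%:R^-1 * \sum_(j < n) r (i + j)%N)))).
  apply: ler_sum => i _; apply: (le_trans (Hg _ _)).
  rewrite lerD2l ler_wpM2l// ler_wpM2l ?invr_ge0//.
  by apply: ler_sum => j _; rewrite /r addnC !iterD.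
rewrite big_split/= sumr_const card_ord -!mulr_sumr exchange_big/=.
(* Each of the three terms is at most [m * e]: the modulus error, the orbit distance through
   [K * d <= e], and the shift error by the choice of [m]. Hence the factor 3. *)
apply: (@le_trans _ _ (m%:R * e + K * (m%:R * a + n%:R * D))).
  rewrite -[e *+ m]mulr_natl lerD2l ler_wpM2l// mulrC ler_pdivrMr//.
  apply: (@le_trans _ _ (\sum_(j < n) (m%:R * a + n%:R * D))).
    by apply: ler_sum => j _; exact: bnd.
  by rewrite sumr_const card_ord -[leLHS]mulr_natr.
move: mbig; rewrite ler_pdivrMr// => mbig.
have : K * (m%:R * a) <= m%:R * e.
  rewrite mulrCA ler_pM2l// (le_trans _ Kd)// ler_wpM2l// ltW//.
by rewrite [K * (_ + _)]mulrDr; move: mbig; move: (K * (n%:R * D)) (K * _) => b c; lra.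
Unshelve. all: by end_near. Qed.

End orbits.

(** * The limit functional along the orbit of [x] and the measure representing it *)

Section limit_of_generic_points.
Context {R : realType} {X : pointedMetricType R}.
Variables (T : X -> X) (mus : nat -> probability (borel X) R) (xs : nat -> X) (x : X).
Hypotheses (compactX : compact [set: X]) (cT : continuous T)
  (ergmus : forall p, ergodic_measures T (mus p))
  (genxs : forall p, generic_point T (xs p) (mus p))
  (cvgxs : besicovitch T (xs p) x @[p --> \oo] --> (0 : R)).
Implicit Types (f g : X -> R).

Local Notation A f := (birkhoff_average T f).

Let bm f : continuous f -> bounded_measurable (f : borel X -> R).
Proof. exact: continuous_bounded_measurable. Qed.

Let cvg_xs p f : continuous f ->
  A f m (xs p) @[m --> \oo] --> Rintegral (mus p) setT f.
Proof. by have /generic_pointP := @genxs p; exact. Qed.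

Let cvg_near_le (u : nat -> R) (l : R) (e : R) : u @ \oo --> l -> 0 < e ->
  \forall m \near \oo, `|u m - l| <= e.
Proof. by move=> /cvgr_distC_le ul e0; exact: ul. Qed.

(* [p] is independent of [n]; this is applied to [g = |A f n - a|] with [n]
   provided by the ergodicity of [mus p]. *)
Lemma exists_close_orbit f (e : R) : continuous f -> 0 < e ->
  exists p, forall (n : nat), (0 < n)%N -> forall g,
    (forall y z, `|g y - g z| <= `|A f n y - A f n z|) ->
    \forall m \near \oo, `|A g m (xs p) - A g m x| <= e.
Proof.
move=> cf e0; pose d := e / 3; have d0 : 0 < d by rewrite /d; lra.
have [K K0 HK] := continuous_modulus compactX cf d0.
have K1 : 0 < K + 1 by rewrite ltr_wpDl.
have dK0 : 0 < d / (K + 1) by exact: divr_gt0.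
have [p _ Hp] := cvgr_lt 0 cvgxs _ dK0.
exists p => n n0 g Hg.
have nR : 0 < n%:R :> R by rewrite ltr0n.
have -> : e = 3 * d by rewrite /d mulrC divfK.
apply: (orbit_close compactX K0 d0 n0 (d := d / (K + 1))).
- by rewrite mulrA ler_pdivrMr// mulrC ler_wpM2l ?ltW// ltrDl.
- by apply: besicovitch_lt => //; exact: (Hp p (leqnn p)).
move=> y w; apply: (le_trans (Hg y w)).
rewrite /birkhoff_average -mulrBr /birkhoff_sum -sumrB normrM ger0_norm ?invr_ge0//.
apply: (@le_trans _ _ (n%:R^-1 *
    \sum_(i < n) (d + K * mdist (iter i T y) (iter i T w)))).
  rewrite ler_wpM2l ?invr_ge0//; apply: (le_trans (ler_norm_sum _ _ _)).
  by apply: ler_sum => i _; exact: HK.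
rewrite big_split/= sumr_const card_ord -mulr_sumr mulrDr -[d *+ n]mulr_natl.
by rewrite mulKf ?gt_eqF// mulrCA.
Qed.

Let avg1 f y : A f 1 y = f y.
Proof. by rewrite /birkhoff_average invr1 mul1r /birkhoff_sum big_ord1. Qed.

(** A Cauchy argument with the integral of [f] against a suitable [mus p] as the centre of each
    ball. The case [n = 1] of the orbit estimate applies, because [A f 1] is [f]. *)
Lemma averages_cvg f : continuous f -> cvgn (fun m => A f m x).
Proof.
move=> cf; apply/cauchy_cvgP/cauchy_exP => e e0.
have e40 : 0 < e / 4 by exact: divr_gt0.
have [p Hp] := exists_close_orbit cf e40.
exists (Rintegral (mus p) setT f).
have H1 : \forall m \near \oo, `|A f m (xs p) - A f m x| <= e / 4.
  by apply: (Hp 1%N) => // y z; rewrite !avg1.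
have H2 := cvg_near_le (cvg_xs (p := p) cf) e40.
suff: \forall m \near \oo, ball (Rintegral (mus p) setT f) e (A f m x) by [].
near=> m.
have h1 : `|A f m (xs p) - A f m x| <= e / 4 by near: m.
have h2 : `|A f m (xs p) - Rintegral (mus p) setT f| <= e / 4 by near: m.
rewrite /= -ball_normE /=.
move: h1 h2; rewrite !ler_norml => /andP[a1 a2] /andP[b1 b2].
by rewrite ltr_norml; apply/andP; split; lra.
Unshelve. all: by end_near. Qed.

Let L f : R := limn (fun m => A f m x).

Let cvgL f : continuous f -> A f m x @[m --> \oo] --> L f.
Proof. exact: averages_cvg. Qed.

Let LE f l : A f m x @[m --> \oo] --> (l : R) -> L f = l.
Proof. by move=> H; exact/cvg_lim. Qed.

Lemma limit_functional_positive : positive_functional L.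
Proof.
split.
- move=> f g cf cg; apply: LE.
  under eq_fun do rewrite birkhoff_averageD.
  by apply: cvgD; exact: cvgL.
- move=> a f cf; apply: LE.
  under eq_fun do rewrite birkhoff_averageZ.
  by apply: cvgM; [exact: cvg_cst|exact: cvgL].
- move=> f g cf cg fg; apply: ler_lim; [exact: averages_cvg..|].
  by apply: nearW => m; exact: le_birkhoff_average.
- apply: LE; apply: cvg_near_cst; near=> m.
  by rewrite birkhoff_average_cst//; near: m; exact: nbhs_infty_gt.
Unshelve. all: by end_near. Qed.

Let posL := limit_functional_positive.

Let L_near f p (e : R) : continuous f ->
  (\forall m \near \oo, `|A f m (xs p) - A f m x| <= e) ->
  `|Rintegral (mus p) setT f - L f| <= e.
Proof.
move=> cf H.
have : A f m (xs p) - A f m x @[m --> \oo] --> Rintegral (mus p) setT f - L f.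
  by apply: cvgB; [exact: cvg_xs|exact: cvgL].
move=> /cvg_norm Hc; rewrite -(cvg_lim _ Hc)//; apply: limr_le => //.
by apply/cvg_ex; eexists; exact: Hc.
Qed.

Lemma limit_functional_invariant f : continuous f -> L (f \o T) = L f.
Proof.
move=> cf; apply: LE; have [M HM] := continuous_bounded compactX cf.
have M0 : 0 <= M := le_trans (normr_ge0 _) (HM x).
(* Shifting the sum by one step leaves two boundary terms, which are bounded and vanish after
   division by [m]. *)
have -> : (fun m => A (f \o T) m x) =
    (fun m => A f m x + m%:R^-1 * (f (iter m T x) - f x)).
  apply/funext => m; rewrite /birkhoff_average -mulrDr; congr (_ * _).
  have -> : birkhoff_sum T (f \o T) m x = birkhoff_sum T f m (T x).
    by apply: eq_bigr => i _; rewrite /= -iterS iterSr.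
  have := birkhoff_sumS T f m x.
  rewrite {1}/birkhoff_sum big_ord_recr/= -/(birkhoff_sum T f m x).
  by move: (birkhoff_sum _ _ _ _) (birkhoff_sum _ _ _ _) => a b; lra.
rewrite -[X in _ --> X]addr0; apply: cvgD; first exact: cvgL.
apply/cvgrPdist_le => e e0; near=> m.
have m0 : 0 < m%:R :> R by rewrite ltr0n; near: m; exact: nbhs_infty_gt.
have mbig : (M + M) / e <= m%:R by near: m; exact: nbhs_infty_ger.
rewrite sub0r normrN normrM ger0_norm ?invr_ge0// mulrC ler_pdivrMr//.
rewrite mulrC -ler_pdivrMr//; apply: le_trans mbig.
rewrite ler_wpM2r ?invr_ge0//; first exact: ltW.
by rewrite (le_trans (ler_normB _ _))// lerD.
Unshelve. all: by end_near. Qed.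

(** Three errors of [e / 3]: replacing [L f] by the integral [c] against [mus p], the mean ergodic
    theorem for [mus p], and the passage from [mus p] back to [L] for the function under the
    absolute value. *)
Lemma limit_functional_mean f (e : R) : continuous f -> 0 < e ->
  exists2 n, (0 < n)%N & L (fun y => `|A f n y - L f|) <= e.
Proof.
move=> cf e0; have e30 : 0 < e / 3 by exact: divr_gt0.
have [p Hp] := exists_close_orbit cf e30.
have cp : `|Rintegral (mus p) setT f - L f| <= e / 3.
  by apply: L_near => //; apply: (Hp 1%N) => // y z; rewrite !avg1.
have [n n0 Hn] := ergodic_mean compactX cT (ergmus p) cf e30.
exists n => //; set c := Rintegral _ _ _ in cp Hn.
have cA : continuous (A f n) by exact: birkhoff_average_continuous.
have cG a : continuous (fun y => `|A f n y - a|).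
  by apply/real_continuous_norm/real_continuousB => //; exact: real_continuous_cst.
have : `|Rintegral (mus p) setT (fun y => `|A f n y - L f|) -
    L (fun y => `|A f n y - L f|)| <= e / 3.
  apply: L_near => //; apply: (Hp n n0) => y z.
  apply: (le_trans (ler_dist_dist _ _)).
  by rewrite opprB addrA subrK.
have : Rintegral (mus p) setT (fun y => `|A f n y - L f|) <=
    Rintegral (mus p) setT (fun y => `|A f n y - c| + e / 3).
  apply: le_Rintegral_bm; first exact: bm.
    exact: (bounded_measurableD (bm (cG c)) (bounded_measurable_cst _)).
  move=> y; have -> : A f n y - L f = (A f n y - c) + (c - L f).
    by rewrite addrA subrK.
  by rewrite (le_trans (ler_normD _ _))// lerD2l.
rewrite (Rintegral_bmD _ (bm (cG c)) (bounded_measurable_cst _)) Rintegral_prob_cst.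
by rewrite ler_norml => ? /andP[? ?]; lra.
Qed.

Variable mu : probability (borel X) R.
Hypothesis muE : forall B, mu B = riesz_outer L B.

Let muL f : continuous f -> Rintegral mu setT f = L f.
Proof. exact: riesz_integral. Qed.

Lemma limit_measure_generic : generic_point T x mu.
Proof. by apply/generic_pointP => f cf; rewrite muL//; exact: cvgL. Qed.

(** Composing the majorants of [B] with [T] majorizes the preimage with the same [L]-values, which
    gives one inequality; applied to the complement of [B], it gives the other. *)
Lemma limit_measure_invariant : invariant_measure T mu.
Proof.
have mT B : measurable (B : set (borel X)) -> measurable (T @^-1` B : set (borel X)).
  by move=> mB; rewrite -[X in measurable X]setTI; exact: (continuous_borel cT).
have half (B : set (borel X)) : measurable B -> (mu (T @^-1` B) <= mu B)%E.
  move=> mB; rewrite !muE lee_fin; apply/ler_addgt0Pr => e e0.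
  have [h [ch h0 hm hB] hr] := riesz_outer_adherent posL B e0.
  apply: (riesz_outer_le posL); exists (fun k => h k \o T); last first.
    by move=> k; rewrite limit_functional_invariant.
  split.
  - by move=> k; exact: real_continuous_comp.
  - by move=> k y; exact: h0.
  - by move=> k l y kl; exact: hm.
  - by move=> y /hB.
move=> B mB; apply/eqP; rewrite eq_le half//=.
have := half _ (measurableC mB); rewrite preimage_setC (probability_setC mu (mT B mB)).
rewrite (probability_setC mu mB) -(fineK (fin_num_measure mu _ mB)).
rewrite -(fineK (fin_num_measure mu _ (mT B mB))) -!EFinB !lee_fin.
by rewrite lerD2l lerN2.
Qed.

(** Take a majorant [h k] of most of [B], namely of [E], with [c = L (h k)] at most [m + e]. Its
    averages are nearly the constant [c] in mean, while those of [\1_E] vanish off the invariant set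
    [B]. Integrating gives [mu E <= c * m + e], hence [m <= m * m + 3 * e]. *)
Lemma limit_measure_ergodic : ergodic_measures T mu.
Proof.
split; first exact: limit_measure_invariant.
move=> B mB TB; pose m := fine (mu B).
have mE : mu B = m%:E by rewrite fineK// fin_num_measure.
have m0 : 0 <= m by rewrite fine_ge0.
have m1 : m <= 1 by rewrite -lee_fin -mE probability_le1.
suff mm : m <= m * m.
  rewrite mE; have [m00|m00] := eqVneq m 0; first by left; rewrite m00.
  right; congr EFin; apply/eqP; rewrite eq_le m1/=.
  by rewrite -(ler_pM2l (_ : 0 < m)) ?mulr1// lt_neqAle eq_sym m00.
apply/ler_addgt0Pr => e0 e00; pose e := e0 / 3.
have e_gt0 : 0 < e by exact: divr_gt0.
have [h [ch h0 hm hB] hr] := riesz_outer_adherent posL B e_gt0.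
rewrite -muE -/m in hr.
pose F k : set (borel X) := B `&` [set y | h k y < 1].
have mlt k : measurable ([set y | h k y < 1] : set (borel X)).
  rewrite -[X in measurable X]setTI.
  have -> : [set y | h k y < 1] = h k @^-1` `]-oo, 1[.
    by apply/seteqP; split=> z /=; rewrite in_itv.
  exact: (continuous_borel_real (ch k)).
have mF k : measurable (F k) by exact: measurableI.
(* Every point of [B] is majorized from some stage on, so the sets [F k] decrease to the empty
   set. *)
have [||k Fk] := decreasing_null (mu := mu) (e := e) mF _ _ e_gt0.
- by move=> k l kl y [By hy]; split => //; exact: le_lt_trans (hm _ _ y kl) hy.
- suff -> : \bigcap_k F k = set0 by rewrite measure0.
  rewrite -subset0 => y Fy; have [By _] := Fy 0%N Logic.I.
  have [k hk] := hB y By; have [_ /=] := Fy k Logic.I.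
  by rewrite ltNge hk.
pose E : set (borel X) := B `\` F k.
have mEs : measurable E by exact: measurableD.
have EB y : E y -> B y /\ 1 <= h k y.
  by move=> [By nF]; split => //; rewrite leNgt; apply/negP => hy; apply: nF.
have muEm : m <= fine (mu E) + e.
  have -> : m = fine (mu E) + fine (mu (F k)).
    rewrite -fineD ?fin_num_measure// -measureU//.
      by rewrite /E setUC setDUK// => y [].
    by rewrite /E setDE -setIA setICl setI0.
  by rewrite lerD2l ltW.
have [n n0 Hn] := limit_functional_mean (ch k) e_gt0.
set c := L (h k) in Hn.
have cm : c <= m + e by exact: hr.
have iterB i y : B (iter i T y) <-> B y.
  by elim: i => [|i ih]//=; rewrite -ih -[X in _ <-> X](congr1 (@^~ (iter i T y)) TB).
(* On [B] this follows from [\1_E <= h k]. Off [B] the orbit never enters [B], so the left side is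
   0; this is what puts the factor [\1_B] on [c]. *)
have le1 y : A (\1_E : X -> R) n y <= c * \1_B y + `|A (h k) n y - c|.
  have [By|nBy] := pselect (B y).
    rewrite [\1_B y]indicE mem_set// mulr1.
    apply: (@le_trans _ _ (A (h k) n y)); last by rewrite -lerBlDl ler_norm.
    apply: le_birkhoff_average => z; rewrite indicE.
    have [Ez|nEz] := pselect (E z); first by rewrite mem_set//; exact: (EB z Ez).2.
    by rewrite memNset.
  rewrite [\1_B y]indicE memNset// mulr0 add0r.
  rewrite /birkhoff_average /birkhoff_sum big1 ?mulr0// => i _.
  by rewrite indicE memNset// => /EB[/iterB].
have b1E := @bounded_measurable_indic _ _ R _ mEs.
have bcB := bounded_measurableM (bounded_measurable_cst c)
  (@bounded_measurable_indic _ _ R _ mB).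
have cG : continuous (fun y => `|A (h k) n y - c|).
  apply/real_continuous_norm/real_continuousB; last exact: real_continuous_cst.
  exact: birkhoff_average_continuous.
have bAE : bounded_measurable (A (\1_E : borel X -> R) n : borel X -> R).
  exact: bounded_measurable_birkhoff_average.
have := le_Rintegral_bm mu bAE (bounded_measurableD bcB (bm cG)) le1.
rewrite (Rintegral_birkhoff_average cT limit_measure_invariant n0 b1E).
rewrite Rintegral_prob_indic// (Rintegral_bmD mu bcB (bm cG)).
rewrite (Rintegral_bmZ mu _ (@bounded_measurable_indic _ _ R _ mB)).
rewrite Rintegral_prob_indic// muL// -/m => H.
have cmm : c * m <= m * m + e.
  apply: (@le_trans _ _ ((m + e) * m)); first by rewrite ler_wpM2r.
  by rewrite mulrDl lerD2l ler_piMr// ltW.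
have -> : e0 = 3 * e by rewrite /e mulrC divfK.
by move: H Hn muEm cmm; move: (fine _) (L _) (c * m) (m * m) => ? ? ? ?; lra.
Qed.

End limit_of_generic_points.

Theorem theorem15 (R : realType) (X : pointedMetricType R)
    (compactX : compact [set: X]) (T : X -> X) (contT : continuous T)
    (mus : nat -> probability (borel X) R) (xs : nat -> X)
    (ergmus : forall p : nat, ergodic_measures T (mus p))
    (genxs : forall p : nat, generic_point T (xs p) (mus p))
    (x : X) (cvgxs : besicovitch T (xs p) x @[p --> \oo] --> (0 : R)) :
  exists2 mu : probability (borel X) R,
    ergodic_measures T mu & generic_point T x mu.
Proof.
pose L f := limn (fun m => birkhoff_average T f m x).
have posL : positive_functional L.
  exact: (limit_functional_positive compactX genxs cvgxs).
have [mu muE] := riesz_probability posL compactX; exists mu.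
  exact: (limit_measure_ergodic compactX contT ergmus genxs cvgxs muE).
exact: (limit_measure_generic compactX genxs cvgxs muE).
Qed.
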